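(* Assume the Continuum Hypothesis. Let $u$ be a non-principal ultrafilter on $\omega$. Then the surjective symmetric span $s^*(\mathbb{I}_u)$ of the continuum $\mathbb{I}_u$ is nonzero; that is, there is a subcontinuum $Z$ of $\mathbb{I}_u\times\mathbb{I}_u$ with $Z=Z^{-1}$, $\pi_1[Z]=\mathbb{I}_u$ and $Z\cap\Delta(\mathbb{I}_u)=\emptyset$.
   Context: A continuum is a (nonempty) compact connected Hausdorff space; a subcontinuum is a subspace that is a continuum. $\beta X$ is the Čech-Stone compactification of $X$. The continuum $\mathbb{I}_u$: let $\mathbb{M}=\omega\times[0,1]$, $\pi:\mathbb{M}\to\omega$, $\pi(n,x)=n$, with Čech-Stone extension $\beta\pi:\beta\mathbb{M}\to\beta\omega$. For $u\in\omega^*=\beta\omega\setminus\omega$ put $\mathbb{I}_u=(\beta\pi)^{-1}(u)$, which is a continuum. For a continuum $X$, $\Delta(X)=\{(x,x):x\in X\}$, $\pi_1,\pi_2:X^2\to X$ are the projections, and $Z^{-1}=\{(y,x):(x,y)\in Z\}$ for $Z\subseteq X^2$. The surjective symmetric span $s^*(X)$ is zero if every subcontinuum $Z$ of $X^2$ with $Z=Z^{-1}$ and $\pi_1[Z]=X$ meets $\Delta(X)$; otherwise it is nonzero. *)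

(* Defs.v *)
From HB Require Import structures.
From mathcomp Require Import all_boot all_order all_algebra.
From mathcomp Require Import all_classical all_reals topology normedtype.

Set Implicit Arguments.
Unset Strict Implicit.
Unset Printing Implicit Defensive.

Import Order.TTheory GRing.Theory Num.Theory.
Import numFieldNormedType.Exports.

Local Open Scope classical_set_scope.
Local Open Scope ring_scope.

(* Every set of reals is countable or has the cardinality of the continuum. *)
Definition continuum_hypothesis (R : realType) : Prop :=
  forall A : set R, countable A \/ (A #= [set: R])%card.

Definition is_continuum (X : topologicalType) : Prop :=
  [/\ [set: X] !=set0, compact [set: X], connected [set: X]
    & hausdorff_space X].

(* A subset coerced to a type, [set_type Z], carries the subspace topology. *)
Definition subcontinuum (X : topologicalType) (Z : set X) : Prop :=
  is_continuum (set_type Z).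

Definition surj_sym_span_zero (X : topologicalType) : Prop :=
  forall Z : set (X * X), subcontinuum Z -> Z = (Z^-1)%relation ->
    fst @` Z = [set: X] -> Z `&` diagonal !=set0.

Section StoneCech.
Context {R : realType}.

Definition I01 : topologicalType := set_type `[(0 : R), 1].

Definition cube (X : topologicalType) : topologicalType :=
  prod_topology (fun _ : continuousType X I01 => I01).

Definition evaluation (X : topologicalType) (x : X) : cube X := fun f => f x.

(* The Cech-Stone compactification, as the closure of the canonical image of X
   in the Tychonoff cube [0,1]^C(X,[0,1]); meaningful for Tychonoff X. *)
Definition beta (X : topologicalType) : topologicalType :=
  set_type (closure (range (@evaluation X))).

Lemma beta_emb_subproof (X : topologicalType) (x : X) :
  evaluation x \in closure (range (@evaluation X)).
Proof. by rewrite inE; apply: subset_closure; exists x. Qed.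

Definition beta_emb (X : topologicalType) (x : X) : beta X :=
  exist _ (evaluation x) (beta_emb_subproof x).

Arguments beta_emb {X} x.

Definition cube_map (X Y : topologicalType) (phi : continuousType X Y)
  (p : cube X) : cube Y := fun g => p (g \o phi : continuousType X I01).

Lemma cube_cvg (X : topologicalType) (F : set_system (cube X))
  {FF : Filter F} (p : cube X) :
  (forall f, (fun q : cube X => q f) @ F --> p f) -> F --> p.
Proof.
move=> cF; apply/cvg_sup => f A [B [[C oC <-] Cp] sBA].
apply: (filterS sBA); apply: (cF f); exact: open_nbhs_nbhs.
Qed.

Lemma cube_coord_continuous (X : topologicalType) (f : continuousType X I01) :
  continuous (fun p : cube X => p f).
Proof. exact: (@proj_continuous _ (fun=> I01) f). Qed.

Lemma cube_map_continuous (X Y : topologicalType) (phi : continuousType X Y) :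
  continuous (cube_map phi).
Proof.
move=> p; apply: (@cube_cvg _ _ (fmap_filter _ (nbhs_filter p))) => g.
exact: (@cube_coord_continuous X (g \o phi : continuousType X I01) p).
Qed.

Lemma evaluation_continuous (X : topologicalType) :
  continuous (@evaluation X).
Proof.
move=> x; apply: (@cube_cvg _ _ (fmap_filter _ (nbhs_filter x))) => f.
exact: (@cts_fun _ _ f x).
Qed.

Lemma cube_map_evaluation (X Y : topologicalType) (phi : continuousType X Y) x :
  cube_map phi (evaluation x) = evaluation (phi x).
Proof. by []. Qed.

Lemma beta_map_subproof (X Y : topologicalType) (phi : continuousType X Y)
  (p : beta X) : cube_map phi (set_val p) \in closure (range (@evaluation Y)).
Proof.
rewrite inE => B nB.
have /(_ _ (@cube_map_continuous _ _ phi _ _ nB)) [_ [[x _ <-] Bx]] :=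
  set_valP p.
by exists (evaluation (phi x)); split=> //; exists (phi x).
Qed.

(* The Cech-Stone extension of [phi]; see [beta_map_emb] and
   [beta_map_continuous]. *)
Definition beta_map (X Y : topologicalType) (phi : continuousType X Y)
  (p : beta X) : beta Y :=
  exist _ (cube_map phi (set_val p)) (beta_map_subproof phi p).

Lemma beta_map_emb (X Y : topologicalType) (phi : continuousType X Y) (x : X) :
  beta_map phi (beta_emb x) = beta_emb (phi x).
Proof. exact: val_inj. Qed.

Lemma set_val_continuous (X : topologicalType) (A : set X) :
  continuous (set_val : set_type A -> X).
Proof. exact: initial_continuous. Qed.

Lemma set_type_cvg (X : topologicalType) (A : set X)
  (F : set_system (set_type A)) {FF : Filter F} (p : set_type A) :
  set_val @ F --> set_val p -> F --> p.
Proof.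
move=> cF B [_ [[W oW <-] Wp] sB]; apply: (filterS sB).
by apply: cF; exact: open_nbhs_nbhs.
Qed.

Lemma beta_map_continuous (X Y : topologicalType) (phi : continuousType X Y) :
  continuous (beta_map phi).
Proof.
move=> p; apply: (@set_type_cvg _ _ _ (fmap_filter _ (nbhs_filter p))).
apply: (@continuous_comp _ _ _ _ (cube_map phi)).
  exact: set_val_continuous.
exact: cube_map_continuous.
Qed.

Lemma beta_emb_continuous (X : topologicalType) : continuous (@beta_emb X).
Proof.
move=> x; apply: (@set_type_cvg _ _ _ (fmap_filter _ (nbhs_filter x))).
exact: evaluation_continuous.
Qed.

Lemma set_type_compact (X : topologicalType) (A : set X) :
  compact A -> compact [set: set_type A].
Proof.
move=> cA F FF _.
have FA : (set_val @ F) A.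
  apply: (@filterS _ F _ setT) => [a _|]; first exact: set_valP.
  exact: filterT.
have [x [Ax clx]] := cA (set_val @ F) (fmap_proper_filter _ FF) FA.
exists (exist _ x (mem_set Ax)); split=> // B C FB [_ [[W oW <-] Wx] sWC].
have FB' : (set_val @ F) (set_val @` B).
  by apply: (@filterS _ F _ B) => [c Bc|//]; exists c.
have [_ [[b Bb <-] Wb]] := clx _ W FB' (open_nbhs_nbhs (conj oW Wx)).
by exists b; split=> //; apply: sWC.
Qed.

Lemma I01_compact : compact [set: I01].
Proof. by apply: set_type_compact; exact: segment_compact. Qed.

Lemma beta_compact (X : topologicalType) : compact [set: beta X].
Proof.
apply: set_type_compact.
apply: (@subclosed_compact _ _ [set f : cube X | forall i, [set: I01] (f i)]).
- exact: closed_closure.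
- exact: (@tychonoff _ (fun _ : continuousType X I01 => I01)
    (fun=> setT) (fun=> I01_compact)).
- by [].
Qed.

Lemma ultrafilter_point_subproof (U : set_system nat) : UltraFilter U ->
  exists p : beta nat, beta_emb @ U --> p.
Proof.
move=> UU; have [|p [_ clp]] := @beta_compact nat (beta_emb @ U)
  (fmap_proper_filter _ (@ultra_proper _ _ UU)); first exact: filterT.
exists p => V nV; rewrite nbhs_simpl /=.
have [//|UVc] := in_ultra_setVsetC (beta_emb @^-1` V) UU.
pose W := beta_emb @` (~` (beta_emb @^-1` V)).
have FW : (beta_emb @ U) W.
  by apply: (@filterS _ U _ (~` (beta_emb @^-1` V))) => [x nVx|//]; exists x.
by have [_ [[x nVx <-] /nVx]] := clp W V FW nV.
Qed.

(* The point of beta omega that an ultrafilter on omega is identified with: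
   the limit in beta omega of the ultrafilter. *)
Definition ultrafilter_point (U : set_system nat) (UU : UltraFilter U) :
  beta nat := projT1 (cid (ultrafilter_point_subproof UU)).

Lemma set_type_hausdorff (X : topologicalType) (A : set X) :
  hausdorff_space X -> hausdorff_space (set_type A).
Proof.
move=> hX p q clpq; apply: val_inj; apply: hX => B C nB nC.
have nB' := @set_val_continuous X A p B nB.
have nC' := @set_val_continuous X A q C nC.
by have [b [Bb Cb]] := clpq _ _ nB' nC'; exists (set_val b).
Qed.

Lemma beta_hausdorff (X : topologicalType) : hausdorff_space (beta X).
Proof.
apply: set_type_hausdorff.
apply: (@hausdorff_product _ (fun _ : continuousType X I01 => I01)) => f.
exact/set_type_hausdorff/order_hausdorff.
Qed.

Definition omega_star : set (beta nat) := ~` range (@beta_emb nat).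

Lemma ultrafilter_point_cvg (U : set_system nat) (UU : UltraFilter U) :
  beta_emb @ U --> ultrafilter_point UU.
Proof. exact: projT2 (cid (ultrafilter_point_subproof UU)). Qed.

Lemma beta_cvg_unique (X : topologicalType) (F : set_system (beta X))
  (p q : beta X) : ProperFilter F -> F --> p -> F --> q -> p = q.
Proof.
move=> FF Fp Fq; apply: beta_hausdorff => A B nA nB.
exact: (@filter_ex _ F FF _ (@filterI _ F FF _ _ (Fp _ nA) (Fq _ nB))).
Qed.

Lemma ultrafilter_point_onto (p : beta nat) :
  exists (U : set_system nat) (UU : UltraFilter U), ultrafilter_point UU = p.
Proof.
pose G : set_system nat := filter_from (nbhs p) (fun B => beta_emb @^-1` B).
have GG : ProperFilter G.
  apply: filter_from_proper.
    apply: filter_from_filter; first by exists setT; exact: filterT.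
    by move=> B C nB nC; exists (B `&` C) => //; exact: filterI.
  move=> B [_ [[W oW <-] Wp] sWB].
  have [_ [[n _ <-] Wn]] := set_valP p W (open_nbhs_nbhs (conj oW Wp)).
  by exists n; apply: sWB.
have [U [UU sGU]] := ultraFilterLemma GG.
exists U, UU; have PU : ProperFilter (beta_emb @ U) :=
  fmap_proper_filter _ (@ultra_proper _ _ UU).
have Up : beta_emb @ U --> p by move=> B nB; apply: sGU; exists B.
exact: (@beta_cvg_unique nat _ _ _ PU (@ultrafilter_point_cvg U UU) Up).
Qed.

(* Under this identification, nonprincipal ultrafilters are the points of
   omega^*. *)
Lemma ultrafilter_point_omega_star (U : set_system nat) (UU : UltraFilter U) :
  omega_star (ultrafilter_point UU) <-> forall n, ~ U [set n].
Proof.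
have PU : ProperFilter (beta_emb @ U) :=
  fmap_proper_filter _ (@ultra_proper _ _ UU).
split=> [nr n Un|nU [n _ eqn]].
  have Un' : beta_emb @ U --> beta_emb n.
    move=> B /nbhs_singleton Bn.
    by apply: (@filterS _ U _ [set n]) => // _ ->.
  apply: nr; exists n => //.
  exact: (@beta_cvg_unique nat _ _ _ PU Un' (@ultrafilter_point_cvg U UU)).
apply: (nU n).
have i0 : (0 : R) \in (`[(0 : R), 1]%classic : set R).
  by rewrite inE /= in_itv /= lexx ler01.
have i1 : (1 : R) \in (`[(0 : R), 1]%classic : set R).
  by rewrite inE /= in_itv /= lexx ler01.
pose f (m : nat) : I01 := if m == n then exist _ 1 i1 else exist _ 0 i0.
have cf : continuous f.
  move=> m A nA; apply: (@filterS _ (nbhs m) _ [set m]); last first.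
    exact: discrete_set1.
  by move=> _ ->; exact: (nbhs_singleton nA).
pose F : continuousType nat I01 := mkcts cf.
pose B : set (beta nat) := [set q | set_val (set_val q F) > 2^-1].
have nB : nbhs (ultrafilter_point UU) B.
  rewrite -eqn.
  have c1 : continuous (fun q : beta nat => set_val (set_val q F) : R).
    move=> q; apply: (@continuous_comp _ _ _ (fun q : beta nat => set_val q F)
      (set_val : I01 -> R)); last exact: set_val_continuous.
    apply: (@continuous_comp _ _ _ (set_val : beta nat -> cube nat)
      (fun q : cube nat => q F)); first exact: set_val_continuous.
    exact: cube_coord_continuous.
  apply: (c1 _ [set x : R | x > 2^-1]); apply: open_nbhs_nbhs; split.
    exact: open_gt.
  rewrite -[set_val _]/(set_val (f n)) /f eqxx /=.
  by rewrite invf_lt1 // ltr1n.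
have := @ultrafilter_point_cvg U UU B nB.
apply: (@filterS _ U) => m.
rewrite -[(_ @^-1` B) m]/(is_true (2^-1 < set_val (f m) :> R)) /f.
by case: eqP => //= _; rewrite ltNge invr_ge0 ler0n.
Qed.

Definition M : topologicalType := (nat * I01)%type.

Lemma M_proj_continuous : continuous (fst : M -> nat).
Proof. by move=> x; exact: cvg_fst. Qed.

Definition M_proj : continuousType M nat := mkcts M_proj_continuous.

(* The fibre of beta pi over u, with the subspace topology. *)
Definition II (u : beta nat) : topologicalType :=
  set_type (beta_map M_proj @^-1` [set u]).

End StoneCech.

Arguments beta R X : clear implicits.
Arguments II R u : clear implicits.

(* Main.v *)
Require Import Defs.
From HB Require Import structures.
From mathcomp Require Import all_boot all_order all_algebra.
From mathcomp Require Import all_classical all_reals topology normedtype.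
From mathcomp Require Import trigo ring lra.

Import Order.TTheory GRing.Theory Num.Theory.
Import numFieldNormedType.Exports.

Local Open Scope classical_set_scope.

(* Map the n-th copy of [0,1] onto a circle with a whisker: the whisker is
   [0,1/2], and [1/2,1] winds n+1 half-turns around the circle.  In the square
   of the n-th copy take the comb consisting of the spine {0} x [1/2,1] and,
   for each odd k, of the points (s,t) whose images are antipodal on the circle
   with t ahead of s by k half-turns, prolonged by letting s run back to the
   tip of the whisker.  The comb is connected and its points have uniformly
   distinct coordinates on the circle with whisker, so its limit W along u is a
   continuum in the square of I_u that misses the diagonal.

   If a_i is the limit along u of the points i half-turns after 1/2, then
   (a_i,a_l) is in W whenever l - i is odd and positive.  Hence, for
   a = lim a_(2i) and b = lim a_(2i+1), both (a,b) and (b,a) are in W.  So W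
   meets its inverse, and the union of the two is a symmetric continuum; it
   projects onto I_u because each comb and its inverse together project onto
   [0,1]. *)

(** * General topology: limits along ultrafilters, products, connected subspaces *)

Lemma ultra_cvg (I : Type) (F : set_system I) (T : topologicalType)
    (f : I -> T) :
  UltraFilter F -> compact [set: T] -> exists p : T, f @ F --> p.
Proof.
move=> UF cT; have [|p [_ clp]] := cT (f @ F)
  (fmap_proper_filter _ (@ultra_proper _ _ UF)); first exact: filterT.
exists p => V nV; rewrite nbhs_simpl /=.
have [//|FVc] := in_ultra_setVsetC (f @^-1` V) UF.
have FW : (f @ F) (f @` (~` (f @^-1` V))).
  by apply: (@filterS _ F _ (~` (f @^-1` V))) => [x nVx|//]; exists x.
by have [_ [[x nVx <-] /nVx]] := clp _ V FW nV.
Qed.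

Lemma hausdorff_prod (T U : topologicalType) :
  hausdorff_space T -> hausdorff_space U -> hausdorff_space (T * U)%type.
Proof.
move=> hT hU [a b] [c d] cl; congr (_, _).
  apply: hT => A B nA nB.
  have [[x y] [/= Ax Bx]] := cl (fst @^-1` A) (fst @^-1` B)
    (@cvg_fst _ _ (nbhs a) (nbhs b) _ _ nA)
    (@cvg_fst _ _ (nbhs c) (nbhs d) _ _ nB).
  by exists x.
apply: hU => A B nA nB.
have [[x y] [/= Ax Bx]] := cl (snd @^-1` A) (snd @^-1` B)
  (@cvg_snd _ _ (nbhs a) (nbhs b) _ _ nA)
  (@cvg_snd _ _ (nbhs c) (nbhs d) _ _ nB).
by exists y.
Qed.

Lemma compact_prodT (T U : topologicalType) :
  compact [set: T] -> compact [set: U] -> compact [set: T * U].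
Proof. by move=> cT cU; rewrite -setXTT; exact: compact_setX. Qed.

Lemma connected_set_typeT (T : topologicalType) (A : set T) :
  connected A -> connected [set: set_type A].
Proof.
move=> cA B [b Bb] [C [O oO <-] BC] [D cD BD].
(* Open sets of the subspace are traces of open sets of [T], so the closed [D] is the trace of the
   complement of an open [P]. *)
have [P oP PD] : open (~` D) by exact: closed_openC.
have ABE : set_val @` B = A.
  apply: cA; first by exists (set_val b), b.
    exists O => //; apply/seteqP; split => [_ [x Bx <-]|x [Ax Ox]].
      by split; [exact: set_valP | move: Bx; rewrite BC => -[]].
    by exists (exist _ x (mem_set Ax)) => //; rewrite BC.
  exists (~` P); first exact: open_closedC.
  apply/seteqP; split => [_ [x Bx <-]|x [Ax Px]].
    split; first exact: set_valP.
    move=> Px; have : (~` D) x by rewrite -PD.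
    by apply; move: Bx; rewrite BD => -[].
  exists (exist _ x (mem_set Ax)) => //; rewrite BD; split => //.
  by apply: contrapT; rewrite -[~ D _]/((~` D) _) -PD.
apply/seteqP; split => // x _.
have : (set_val @` B) (set_val x) by rewrite ABE; exact: set_valP.
by case=> y By /val_inj <-.
Qed.

Lemma connected_open_sub (T : topologicalType) (A U V : set T) :
  connected A -> open U -> open V -> U `&` V = set0 -> A `<=` U `|` V ->
  A `<=` U \/ A `<=` V.
Proof.
move=> cA oU oV UV0 sA.
have [[x [Ax Ux]]|nU] := pselect (A `&` U !=set0); [left|right] => y Ay.
  suff AU : A `&` U = A by move: Ay; rewrite -AU => -[].
  apply: cA; first by exists x.
    by exists U.
  exists (~` V); first exact: open_closedC.
  apply/seteqP; split => z [Az Uz]; split => //.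
    by move=> Vz; have : (U `&` V) z by []; rewrite UV0.
  by case: (sA _ Az).
by case: (sA _ Ay) => // Uy; exfalso; apply: nU; exists y.
Qed.

(** * Limits of sets along an ultrafilter *)

Section UltraLimit.
Context {I : Type} {T : topologicalType}.
Implicit Types (F : set_system I) (S : I -> set T).

(** For an ultrafilter [F] these are the points whose every neighbourhood meets [S n] for [F]-almost
    all [n]. *)
Definition ultralim F S : set T :=
  \bigcap_(U in F) closure (\bigcup_(n in U) S n).

Lemma ultralim_closed F S : closed (ultralim F S).
Proof. by apply: closed_bigI => U _; exact: closed_closure. Qed.

Lemma ultralim_sub_closed F S (C : set T) :
  F setT -> closed C -> (forall n, S n `<=` C) -> ultralim F S `<=` C.
Proof.
move=> FT cC sC p /(_ _ FT) clp; apply: cC.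
by apply: closure_subset clp => x [n _ /sC].
Qed.

(** A point of the limit need not be the limit along [F] of one chosen point in each [S n]. So [G]
    may live on another set [J] lying over [I]; [limit_comb_onto] takes an ultrafilter on [M]. *)
Lemma cvg_ultralim F S (J : Type) (G : set_system J) (c : J -> I)
    (f : J -> T) (p : T) :
  ProperFilter G -> (forall U, F U -> G (c @^-1` U)) ->
  (\near G, S (c G) (f G)) -> f @ G --> p -> ultralim F S p.
Proof.
move=> PG cF Sf fp U FU B nB.
have [j [[/= cj Sj] Bj]] :=
  filter_ex (filterI (filterI (cF _ FU) Sf) (fp _ nB)).
by exists (f j); split => //; exists (c j).
Qed.

(** Normality separates a clopen part [B] and its complement [D] by open sets [P] and [Q]. Almost
    all [S n] lie in their union, since points outside it would have a limit in [ultralim F S]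
    outside it. By connectedness almost all [S n] lie in [P], or almost all in [Q]; then [D] or [B]
    is out of reach. *)
Lemma ultralim_connected (R : realType) F S :
  UltraFilter F -> hausdorff_space T -> compact [set: T] ->
  (forall n, connected (S n)) -> connected (ultralim F S).
Proof.
move=> UF hT cT cS B [b Bb] [O oO BO] [C cC BC].
have PF := @ultra_proper _ _ UF.
apply/seteqP; split => [x|y Wy]; first by rewrite BO => -[].
apply: contrapT => nBy.
have cB : closed B by rewrite BC; apply: closedI => //; exact: ultralim_closed.
pose D := ultralim F S `&` ~` O.
have cD : closed D.
  by apply: closedI; [exact: ultralim_closed | exact: open_closedC].
have Dy : D y by split => // Oy; apply: nBy; rewrite BO.
have BD : B `&` D = set0.
  by apply/seteqP; split => // x []; rewrite BO => -[_ Ox] [].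
have [P [Q [oP oQ sBP sDQ PQ0]]] :=
  (proj1 (@normal_openP R T)) (compact_normal hT cT) B D cB cD BD.
have FPQ : F [set n | S n `<=` P `|` Q].
  have [//|Fn] := in_ultra_setVsetC [set n | S n `<=` P `|` Q] UF.
  (* The value [b] is a filler for those [n] with [S n] inside the union. *)
  have /choice[f fE] : forall n, exists x : T,
      ~ S n `<=` P `|` Q -> S n x /\ ~ (P `|` Q) x.
    move=> n; have [?|/existsNP[x /not_implyP[Sx nx]]] :=
      pselect (S n `<=` P `|` Q); first by exists b.
    by exists x.
  have [p fp] := @ultra_cvg _ _ _ f UF cT.
  have Wp : ultralim F S p.
    apply: (@cvg_ultralim F S I F id f p) => //.
    by apply: filterS Fn => n /fE[].
  have nPQ : ~ (P `|` Q) p.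
    apply: (@closed_cvg _ _ _ _ f (~` (P `|` Q))) fp.
      by apply: open_closedC; exact: openU.
    by apply: filterS Fn => n /fE[].
  exfalso; apply: nPQ; have [Op|nOp] := pselect (O p).
    by left; apply: sBP; rewrite BO.
  by right; apply: sDQ.
have [FP|FnP] := in_ultra_setVsetC [set n | S n `<=` P] UF.
  have [x [[n /= SP /SP Px] Qx]] :=
    Wy _ FP Q (open_nbhs_nbhs (conj oQ (sDQ _ Dy))).
  by have : (P `&` Q) x by []; rewrite PQ0.
have FQ : F [set n | S n `<=` Q].
  apply: filterS (filterI FPQ FnP) => n [/= sPQ nP].
  by have [] := @connected_open_sub _ _ _ _ (cS n) oP oQ PQ0 sPQ.
have Wb : ultralim F S b by move: Bb; rewrite BO => -[].
have [x [[n /= SQ /SQ Qx] Px]] :=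
  Wb _ FQ P (open_nbhs_nbhs (conj oP (sBP _ Bb))).
by have : (P `&` Q) x by []; rewrite PQ0.
Qed.

End UltraLimit.

(** * From a square to the square of a subspace *)

Lemma pair_continuous (S T U : topologicalType) (f : S -> T) (g : S -> U) :
  continuous f -> continuous g -> continuous (fun x => (f x, g x)).
Proof. by move=> cf cg x; exact: (cvg_pair (cf x) (cg x)). Qed.

(** Serves to move the continuum built in the square of the Cech-Stone compactification of [M] into
    the square of the fibre: the set in question is a continuous image of the subspace [V]. *)
Lemma connected_prod_set_type (T : topologicalType) (A : set T)
    (V : set (T * T)) :
  V `<=` A `*` A -> connected V ->
  connected [set z : set_type A * set_type A | V (set_val z.1, set_val z.2)].
Proof.
move=> sVA cV.
have A1 (p : set_type V) : (set_val p).1 \in A.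
  by rewrite inE; have [] := sVA _ (set_valP p).
have A2 (p : set_type V) : (set_val p).2 \in A.
  by rewrite inE; have [] := sVA _ (set_valP p).
pose g (p : set_type V) : set_type A * set_type A :=
  (@exist _ (fun x => x \in A) _ (A1 p), @exist _ (fun x => x \in A) _ (A2 p)).
have cg : continuous g.
  apply: pair_continuous => p.
    apply: (@set_type_cvg _ _ _ (fmap_filter _ (nbhs_filter p))).
    apply: (@continuous_comp _ _ _ (set_val : set_type V -> _) fst).
      exact: set_val_continuous.
    exact: cvg_fst.
  apply: (@set_type_cvg _ _ _ (fmap_filter _ (nbhs_filter p))).
  apply: (@continuous_comp _ _ _ (set_val : set_type V -> _) snd).
    exact: set_val_continuous.
  exact: cvg_snd.
suff -> : [set z | V (set_val z.1, set_val z.2)] = g @` setT.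
  apply: connected_continuous_connected; first exact: connected_set_typeT.
  exact: continuous_subspaceT.
apply/seteqP; split => [[x y] /= Vxy|_ [p _ <-] /=].
  exists (@exist _ (fun p => p \in V) _ (mem_set Vxy)) => //.
  by congr (_, _); exact: val_inj.
by rewrite /= -surjective_pairing; exact: set_valP.
Qed.

(** * Points of the Cech-Stone compactification of [M] and of the fibre over [u] *)

Section Fibre.
Context {R : realType}.
Local Open Scope ring_scope.

Lemma clamp_subproof (t : R) :
  Num.min 1 (Num.max 0 t) \in (`[(0 : R), 1]%classic : set R).
Proof.
by rewrite inE /= in_itv /= le_min ler01 le_max lexx ge_min lexx.
Qed.

(** A total retraction onto [0,1]: points and functions can then be given by real formulas, with
    range conditions postponed to [clampE] and [coord_seg]. *)
Definition clamp (t : R) : @I01 R :=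
  @exist _ (fun x => x \in (`[(0 : R), 1]%classic : set R)) _
    (clamp_subproof t).

Lemma clampE (t : R) : 0 <= t <= 1 -> set_val (clamp t) = t.
Proof.
case/andP=> t0 t1.
by rewrite -[LHS]/(Num.min 1 (Num.max 0 t)) max_r // min_r.
Qed.

Lemma I01_itv (x : @I01 R) : 0 <= (set_val x : R) <= 1.
Proof. by have := set_valP x; rewrite /= in_itv. Qed.

Lemma clampK (x : @I01 R) : clamp (set_val x) = x.
Proof. by apply: val_inj; apply: clampE; exact: I01_itv. Qed.

Lemma clamp_continuous : continuous clamp.
Proof.
move=> t; apply: (@set_type_cvg _ _ _ (fmap_filter _ (nbhs_filter t))).
have c : continuous ((cst 1 : R -> R) \min ((cst 0 : R -> R) \max id)).
  apply: min_fun_continuous; first exact: cst_continuous.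
  apply: max_fun_continuous; first exact: cst_continuous.
  by move=> x; exact: cvg_id.
exact: c.
Qed.

Lemma slicewise_continuous (T : topologicalType) (f : nat * T -> @I01 R) :
  (forall n, continuous (fun x => f (n, x))) -> continuous f.
Proof.
move=> cf [n x] A nA.
exists ([set n], [set y | A (f (n, y))]) => /=.
  by split; [exact: discrete_set1 | exact: (cf n x A nA)].
by move=> [m y] /= [-> ?].
Qed.

Lemma clamp_fun_continuous (h : nat -> R -> R)
    (ch : forall n, continuous (h n)) :
  continuous (fun m : @M R => clamp (h m.1 (set_val m.2))).
Proof.
apply: slicewise_continuous => n x.
apply: (@continuous_comp _ _ _ (fun y : @I01 R => h n (set_val y)) clamp).
  apply: (@continuous_comp _ _ _ (set_val : @I01 R -> R) (h n)).
    exact: set_val_continuous.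
  exact: ch.
exact: clamp_continuous.
Qed.

Definition clamp_fun (h : nat -> R -> R) (ch : forall n, continuous (h n)) :
  continuousType (@M R) (@I01 R) := mkcts (clamp_fun_continuous h ch).

Definition coord (X : topologicalType) (g : continuousType X (@I01 R))
  (p : beta R X) : R := set_val (set_val p g).

Lemma coord_continuous (X : topologicalType) (g : continuousType X (@I01 R)) :
  continuous (coord X g).
Proof.
move=> q; apply: (@continuous_comp _ _ _ (fun q : beta R X => set_val q g)
  (set_val : @I01 R -> R)); last exact: set_val_continuous.
apply: (@continuous_comp _ _ _ (set_val : beta R X -> cube X)
  (fun q : cube X => q g)); first exact: set_val_continuous.
exact: cube_coord_continuous.
Qed.

Definition seg (n : nat) (t : R) : beta R (@M R) := beta_emb (n, clamp t).

Lemma segK (m : @M R) : seg m.1 (set_val m.2) = beta_emb m.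
Proof. by case: m => n x; rewrite /seg clampK. Qed.

Lemma seg_continuous n : continuous (seg n).
Proof.
have c : continuous (fun t => (n, clamp t) : @M R).
  by apply: pair_continuous; [exact: cst_continuous | exact: clamp_continuous].
move=> t; apply: (@continuous_comp _ _ _ _ (@beta_emb R _) _ (c t)).
exact: beta_emb_continuous.
Qed.

Lemma coord_seg (h : nat -> R -> R) (ch : forall n, continuous (h n)) n t :
  0 <= t <= 1 -> 0 <= h n t <= 1 -> coord _ (clamp_fun h ch) (seg n t) = h n t.
Proof.
move=> t01 h01; rewrite -[LHS]/(set_val (clamp (h n (set_val (clamp t))))).
by rewrite (clampE t) // clampE.
Qed.

Section Ultrafilter.
Context {u : set_system nat} (Uu : UltraFilter u).
Let p : beta R nat := ultrafilter_point Uu.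

(** The indicator function of [U] extends continuously, with value 1 at [p] because it is 1 for
    [u]-almost all [n]; [B] is where the extension exceeds 1/2. *)
Lemma ultrafilter_point_nbhs U : u U ->
  exists2 B : set (beta R nat), nbhs p B & forall n, B (beta_emb n) -> U n.
Proof.
move=> uU; have PF := @ultra_proper _ _ Uu.
pose f n : @I01 R := if pselect (U n) then clamp 1 else clamp 0.
have cf : continuous f.
  move=> m A nA; apply: (@filterS _ (nbhs m) _ [set m]); last first.
    exact: discrete_set1.
  by move=> _ ->; exact: (nbhs_singleton nA).
pose g : continuousType nat (@I01 R) := mkcts cf.
exists [set q | 2^-1 < coord _ g q]; last first.
  move=> n; rewrite /= -[coord _ _ _]/(set_val (f n)) /f.
  case: pselect => // nUn; rewrite clampE ?lexx ?ler01 //.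
  by rewrite ltNge invr_ge0 ler0n.
apply: (coord_continuous _ g p [set x : R | 2^-1 < x]).
apply: open_nbhs_nbhs; split; first exact: open_gt.
apply: (@lt_le_trans _ _ 1); first by rewrite invf_lt1 // ltr1n.
have cvg1 : (coord _ g \o @beta_emb R nat) @ u --> coord _ g p.
  apply: cvg_comp (@ultrafilter_point_cvg R u Uu) _.
  exact: coord_continuous.
have near1 : u [set n | 1 <= (coord _ g \o @beta_emb R nat) n].
  apply: (@filterS _ u _ U) => // n Un.
  rewrite /= -[coord _ _ _]/(set_val (f n)) /f.
  by case: pselect => // Un'; rewrite clampE ?lexx ?ler01.
exact: (@closed_cvg _ _ _ PF _ [set x : R | 1 <= x] (@closed_ge R 1) near1
  _ cvg1).
Qed.

(** As [M] is dense, the traces on it of the neighbourhoods of [a] generate a proper filter; [w] is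
    an ultrafilter extending it. *)
Lemma fibre_cvg (a : beta R (@M R)) : beta_map M_proj a = p ->
  exists (w : set_system (@M R)),
    [/\ UltraFilter w, @beta_emb R _ @ w --> a
      & forall U, u U -> w (fst @^-1` U)].
Proof.
move=> ap.
pose G : set_system (@M R) :=
  filter_from (nbhs a) (fun B => @beta_emb R _ @^-1` B).
have GG : ProperFilter G.
  apply: filter_from_proper.
    apply: filter_from_filter; first by exists setT; exact: filterT.
    by move=> B C nB nC; exists (B `&` C) => //; exact: filterI.
  move=> B [_ [[W oW <-] Wp] sWB].
  have [_ [[n _ <-] Wn]] := set_valP a W (open_nbhs_nbhs (conj oW Wp)).
  by exists n; apply: sWB.
have [w [Uw sGw]] := ultraFilterLemma GG.
exists w; split => // [B nB|U uU]; first by apply: sGw; exists B.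
have [B nB BU] := ultrafilter_point_nbhs U uU.
apply: sGw; exists (beta_map M_proj @^-1` B).
  by apply: beta_map_continuous; rewrite ap.
by move=> m; rewrite /= beta_map_emb; exact: BU.
Qed.

Lemma cluster_fibre (a : beta R (@M R)) :
  (forall U, u U -> closure [set seg n t | n in U & t in setT] a) ->
  beta_map M_proj a = p.
Proof.
move=> cla; apply: beta_hausdorff => A B nA nB.
have uB := @ultrafilter_point_cvg R u Uu B nB.
have [_ [[n Bn [t _ <-]] An]] :=
  cla _ uB _ (@beta_map_continuous R _ _ M_proj a A nA).
by exists (beta_emb n); split => //; move: An; rewrite /= beta_map_emb.
Qed.

End Ultrafilter.
End Fibre.

(** * The combs in the squares of the segments *)

Section Comb.
Context {R : realType}.
Local Open Scope ring_scope.
Local Notation K := (beta R (@M R)).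

(** The length of one half-turn: [n.+1] of them fill [1/2,1]. *)
Definition pitch (n : nat) : R := (2 * n.+1%:R)^-1.

Lemma pitch_gt0 n : 0 < pitch n.
Proof. by rewrite invr_gt0 mulr_gt0. Qed.

Lemma natr_pitch_le n k : (k <= n.+1)%N -> k%:R * pitch n <= 2^-1.
Proof.
move=> kn; rewrite /pitch invfM mulrCA ler_piMr ?invr_ge0 //.
by rewrite ler_pdivrMr ?mul1r ?ler_nat.
Qed.

Lemma natr_pitch_ge0 n k : 0 <= k%:R * pitch n.
Proof. by rewrite mulr_ge0 // ltW // pitch_gt0. Qed.

Definition spine n : set (K * K) :=
  (fun t => (seg n 0, seg n t)) @` `[2^-1, 1].

(** The maximum freezes the second coordinate while the first runs along the whisker; the bound on
    [t] keeps the second coordinate at most 1. *)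
Definition tooth n k : set (K * K) :=
  (fun t => (seg n t, seg n (Num.max t 2^-1 + k%:R * pitch n))) @`
    `[0, 1 - k%:R * pitch n].

Definition comb n : set (K * K) :=
  \bigcup_(k in [set k | odd k && (k <= n.+1)%N]) (spine n `|` tooth n k).

Lemma comb_spine n t : 2^-1 <= t <= 1 -> comb n (seg n 0, seg n t).
Proof. by move=> t1; exists 1%N => //; left; exists t. Qed.

Lemma comb_tooth n k t : odd k -> (k <= n.+1)%N ->
  0 <= t <= 1 - k%:R * pitch n ->
  comb n (seg n t, seg n (Num.max t 2^-1 + k%:R * pitch n)).
Proof.
by move=> ok kn t1; exists k; [apply/andP | right; exists t].
Qed.

Lemma max_half_continuous : continuous (fun t : R => Num.max t 2^-1).
Proof.
apply: (@max_fun_continuous _ R R id (cst 2^-1)) => [x|]; first exact: cvg_id.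
exact: cst_continuous.
Qed.

(** Each tooth meets the spine at its end [t = 0], and the resulting pieces all contain the spine's
    point (0,1). *)
Lemma comb_connected n : connected (comb n).
Proof.
have s1 : spine n (seg n 0, seg n 1).
  by exists 1 => //; rewrite /= in_itv /= lexx andbT invf_le1 // ler1n.
apply: bigcup_connected; first by exists (seg n 0, seg n 1) => k _; left.
move=> k /andP[ok kn].
have k0 := natr_pitch_ge0 n k; have k1 := natr_pitch_le n k kn.
apply: connectedU.
- exists (seg n 0, seg n (Num.max 0 2^-1 + k%:R * pitch n)); split.
    exists (Num.max 0 2^-1 + k%:R * pitch n) => //.
    by rewrite /= in_itv /= max_r ?invr_ge0 //; lra.
  by exists 0 => //; rewrite /= in_itv /=; lra.
- apply: connected_continuous_connected; first exact: segment_connected.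
  apply: continuous_subspaceT; apply: pair_continuous; last first.
    exact: seg_continuous.
  exact: cst_continuous.
- apply: connected_continuous_connected; first exact: segment_connected.
  apply: continuous_subspaceT; apply: pair_continuous => [|t].
    exact: seg_continuous.
  apply: (@continuous_comp _ _ _ (fun t : R => Num.max t 2^-1 + k%:R * pitch n)
    (seg n)); last exact: seg_continuous.
  by apply: cvgD; [exact: max_half_continuous | exact: cvg_cst].
Qed.

Lemma comb_seg n z : comb n z -> exists s t, z = (seg n s, seg n t).
Proof. by case=> k _ [] [t _ <-]; eexists _, _. Qed.

(** * A continuous function separating the combs from the diagonal *)

Definition phase (n : nat) (t : R) : R :=
  (Num.max t 2^-1 - 2^-1) / pitch n * pi.

Lemma phase_continuous n : continuous (phase n).
Proof.
move=> t; rewrite /phase.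
apply: cvgM; last exact: cvg_cst.
apply: cvgM; last exact: cvg_cst.
apply: cvgB; first exact: max_half_continuous.
exact: cvg_cst.
Qed.

Lemma phase_tooth n k t :
  phase n (Num.max t 2^-1 + k%:R * pitch n) = phase n t + pi *+ k.
Proof.
have p0 := pitch_gt0 n; have k0 := natr_pitch_ge0 n k.
rewrite /phase [X in (X - _) / _]max_l; last first.
  by apply: ler_wpDr => //; rewrite le_max lexx orbT.
rewrite -[pi *+ k]mulr_natl.
by field; rewrite gt_eqF.
Qed.

(* Coordinates of the map to the circle with a whisker, rescaled to [0,1] so
   that they extend to the Cech-Stone compactification. *)
Definition fold_cos n t : R := (1 + cos (phase n t)) / 2.
Definition fold_sin n t : R := (1 + sin (phase n t)) / 2.
Definition fold_min (n : nat) (t : R) : R := Num.min t 2^-1.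

Lemma fold_cos_continuous n : continuous (fold_cos n).
Proof.
move=> t; apply: cvgM; last exact: cvg_cst.
apply: cvgD; first exact: cvg_cst.
apply: continuous_comp; first exact: phase_continuous.
exact: continuous_cos.
Qed.

Lemma fold_sin_continuous n : continuous (fold_sin n).
Proof.
move=> t; apply: cvgM; last exact: cvg_cst.
apply: cvgD; first exact: cvg_cst.
apply: continuous_comp; first exact: phase_continuous.
exact: continuous_sin.
Qed.

Lemma fold_min_continuous n : continuous (fold_min n).
Proof.
apply: (@min_fun_continuous _ R R id (cst 2^-1)) => [x|]; first exact: cvg_id.
exact: cst_continuous.
Qed.

Lemma fold_cos_itv n t : 0 <= fold_cos n t <= 1.
Proof.
have := cos_geN1 (phase n t); have := cos_le1 (phase n t).
by rewrite /fold_cos; lra.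
Qed.

Lemma fold_sin_itv n t : 0 <= fold_sin n t <= 1.
Proof.
have := sin_geN1 (phase n t); have := sin_le1 (phase n t).
by rewrite /fold_sin; lra.
Qed.

Lemma fold_min_itv n t : 0 <= t <= 1 -> 0 <= fold_min n t <= 1.
Proof. by move=> t01; rewrite /fold_min; case: (leP t 2^-1) => ?; lra. Qed.

Definition coord_dist (h : nat -> R -> R) (ch : forall n, continuous (h n))
  (z : K * K) : R :=
  `|coord _ (clamp_fun h ch) z.1 - coord _ (clamp_fun h ch) z.2|.

Lemma coord_dist_continuous h ch : continuous (coord_dist h ch).
Proof.
move=> z; apply: (@continuous_comp _ _ _
  (fun z : K * K => coord _ (clamp_fun h ch) z.1 - coord _ (clamp_fun h ch) z.2)
  (fun x : R => `|x|)); last exact: norm_continuous.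
apply: cvgB.
  apply: (@continuous_comp _ _ _ fst (coord _ (clamp_fun h ch))).
    exact: cvg_fst.
  exact: coord_continuous.
apply: (@continuous_comp _ _ _ snd (coord _ (clamp_fun h ch))).
  exact: cvg_snd.
exact: coord_continuous.
Qed.

Lemma coord_dist_seg h ch n s t : 0 <= s <= 1 -> 0 <= t <= 1 ->
  0 <= h n s <= 1 -> 0 <= h n t <= 1 ->
  coord_dist h ch (seg n s, seg n t) = `|h n s - h n t|.
Proof. by move=> *; rewrite /coord_dist /= !coord_seg. Qed.

Definition total_dist (z : K * K) : R :=
  coord_dist fold_cos fold_cos_continuous z +
  coord_dist fold_sin fold_sin_continuous z +
  coord_dist fold_min fold_min_continuous z.

Lemma total_dist_continuous : continuous total_dist.
Proof.
move=> z; apply: cvgD; last exact: coord_dist_continuous.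
by apply: cvgD; exact: coord_dist_continuous.
Qed.

Lemma total_dist_diag a : total_dist (a, a) = 0.
Proof. by rewrite /total_dist /coord_dist /= !subrr !normr0 !addr0. Qed.

Lemma normr_cosDsin_ge1 (x : R) : 1 <= `|cos x| + `|sin x|.
Proof.
rewrite -(cos2Dsin2 x) -(real_normK (num_real (cos x))).
rewrite -(real_normK (num_real (sin x))).
apply: lerD; rewrite expr2 ler_piMl ?normr_ge0 // ler_norml.
  by rewrite cos_geN1 cos_le1.
by rewrite sin_geN1 sin_le1.
Qed.

(** On the spine [fold_min] contributes |0 - 1/2|. On a tooth the phases differ by an odd multiple
    of pi, so cosine and sine change sign and the first two terms become |cos| + |sin|, which is at
    least 1. *)
Lemma comb_total_dist n z : comb n z -> 2^-1 <= total_dist z.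
Proof.
case=> k /andP[ok kn] [] [t]; rewrite /= in_itv /= => /andP[t0 t1] <-.
  have t01 : 0 <= t <= 1 by lra.
  have z01 : 0 <= (0 : R) <= 1 by rewrite lexx ler01.
  rewrite /total_dist (coord_dist_seg fold_min) ?fold_min_itv //.
  rewrite /fold_min (min_l (x := 0)) ?invr_ge0 // min_r // sub0r normrN.
  rewrite ger0_norm ?invr_ge0 // lerDr.
  by rewrite addr_ge0 // normr_ge0.
have k0 := natr_pitch_ge0 n k; have k1 := natr_pitch_le n k kn.
have t01 : 0 <= t <= 1 by lra.
have m01 : 0 <= Num.max t 2^-1 + k%:R * pitch n <= 1.
  by case: (leP t 2^-1) => ?; lra.
rewrite /total_dist (coord_dist_seg fold_cos) ?fold_cos_itv //.
rewrite (coord_dist_seg fold_sin) ?fold_sin_itv //.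
rewrite /fold_cos /fold_sin phase_tooth.
rewrite (alternatingn (@cosDpi R)) (alternatingn (@sinDpi R)).
rewrite -signr_odd ok expr1 !mulN1r.
have -> : (1 + cos (phase n t)) / 2 - (1 - cos (phase n t)) / 2 =
    cos (phase n t).
  by field.
have -> : (1 + sin (phase n t)) / 2 - (1 - sin (phase n t)) / 2 =
    sin (phase n t).
  by field.
have := normr_cosDsin_ge1 (phase n t).
have : 0 <= coord_dist fold_min fold_min_continuous
  (seg n t, seg n (Num.max t 2^-1 + k%:R * pitch n)) by exact: normr_ge0.
by lra.
Qed.

End Comb.

(** * The limit of the combs along [u], and the symmetric continuum *)

Section Main.
Context {R : realType} {u : set_system nat} (Uu : UltraFilter u).
Context (nonprincipal_u : forall n : nat, ~ u [set n]).
Local Open Scope ring_scope.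
Local Notation K := (beta R (@M R)).
Local Notation p := (@ultrafilter_point R u Uu).

Let PF : ProperFilter u := @ultra_proper _ _ Uu.

Lemma nonprincipal_geq i : u [set n | (i <= n)%N].
Proof.
elim: i => [|i IH]; first by apply: (@filterS _ u _ setT) => //; exact: filterT.
have ui : u (~` [set i]).
  by have [/nonprincipal_u|] := in_ultra_setVsetC [set i] Uu.
apply: (@filterS _ u _ _ _ _ (filterI IH ui)) => n /= [].
by rewrite leq_eqVlt => /orP[/eqP -> /(_ erefl)|].
Qed.

Definition limit_comb : set (K * K) := ultralim u comb.

Lemma betaM_hausdorff2 : hausdorff_space (K * K)%type.
Proof. by apply: hausdorff_prod; exact: beta_hausdorff. Qed.

Lemma betaM_compact2 : compact [set: K * K].
Proof. by apply: compact_prodT; exact: beta_compact. Qed.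

Lemma limit_comb_connected : connected limit_comb.
Proof.
apply: (@ultralim_connected _ _ R) => //.
- exact: betaM_hausdorff2.
- exact: betaM_compact2.
- exact: comb_connected.
Qed.

Lemma limit_comb_fibre a b : limit_comb (a, b) ->
  beta_map M_proj a = p /\ beta_map M_proj b = p.
Proof.
move=> Wab; split; apply: cluster_fibre => U uU B nB.
  have [[x y] [[n Un /comb_seg[s [t [-> ->]]]] /= Bx]] :=
    Wab U uU (fst @^-1` B) (@cvg_fst _ _ (nbhs a) (nbhs b) _ _ nB).
  by exists (seg n s); split => //; exists n => //; exists s.
have [[x y] [[n Un /comb_seg[s [t [-> ->]]]] /= Bx]] :=
  Wab U uU (snd @^-1` B) (@cvg_snd _ _ (nbhs a) (nbhs b) _ _ nB).
by exists (seg n t); split => //; exists n => //; exists t.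
Qed.

(** The lower bound on [total_dist] is a closed condition, so it passes from the combs to their
    limit. *)
Lemma limit_comb_irreflexive a : ~ limit_comb (a, a).
Proof.
move=> Waa.
have : 2^-1 <= total_dist (a, a) :> R.
  apply: (@ultralim_sub_closed _ _ u comb [set z | 2^-1 <= total_dist z]) Waa.
  - exact: filterT.
  - apply: ((continuous_closedP total_dist).1 (@total_dist_continuous R)
      [set x : R | 2^-1 <= x]); exact: closed_ge.
  - exact: comb_total_dist.
by rewrite total_dist_diag invr_le0 lern0.
Qed.

(** When [i] exceeds [n.+1] the argument passes 1 and [seg] clamps it; for fixed [i] this affects
    only finitely many [n]. *)
Definition mark (i n : nat) : K := seg n (2^-1 + i%:R * pitch n).

Lemma comb_mark i l n : (i < l)%N -> odd (l - i) -> (l <= n.+1)%N ->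
  comb n (mark i n, mark l n).
Proof.
move=> il ol ln; rewrite /mark.
have i0 := @natr_pitch_ge0 R n i.
have l1 := @natr_pitch_le R n l ln.
have lE : l%:R * pitch n = i%:R * pitch n + (l - i)%:R * pitch n :> R.
  by rewrite -mulrDl -natrD subnKC // ltnW.
have -> : 2^-1 + l%:R * pitch n =
    Num.max (2^-1 + i%:R * pitch n) 2^-1 + (l - i)%:R * pitch n :> R.
  by rewrite max_l ?lerDl //; lra.
apply: comb_tooth => //; first exact: leq_trans (leq_subr _ _) ln.
by lra.
Qed.

(** Two iterated limits: in each pair of marks the larger index [l] goes to its limit first, with
    [i] fixed, and then [i] does. For (a,b) the smaller index is even, for (b,a) it is odd. *)
Lemma limit_comb_swap : exists a b, limit_comb (a, b) /\ limit_comb (b, a).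
Proof.
have /choice[m mP] i : exists x : K, mark i @ u --> x.
  by apply: ultra_cvg => //; exact: beta_compact.
have Wm i l : (i < l)%N -> odd (l - i) -> limit_comb (m i, m l).
  move=> il ol.
  apply: (@cvg_ultralim _ _ u comb _ u id (fun n => (mark i n, mark l n)))
    => //.
    apply: (@filterS _ u _ _ _ _ (nonprincipal_geq l)) => n ln.
    by apply: comb_mark => //; exact: leqW.
  exact: (cvg_pair (mP i) (mP l)).
have cstu (x : K) : (fun=> x) @ u --> x by exact: cvg_cst.
have cW : closed limit_comb by exact: ultralim_closed.
have [a aP] := @ultra_cvg _ _ _ (fun i => m i.*2) Uu (@beta_compact R M).
have [b bP] := @ultra_cvg _ _ _ (fun i => m i.*2.+1) Uu (@beta_compact R M).
exists a, b; split.
  have Wb i : limit_comb (m i.*2, b).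
    apply: (@closed_cvg _ _ u PF (fun l => (m i.*2, m l.*2.+1)) limit_comb cW).
      apply: (@filterS _ u _ _ _ _ (nonprincipal_geq i)) => l /= il.
      apply: Wm; first by rewrite ltnS leq_double.
      by rewrite subSn ?leq_double //= -doubleB odd_double.
    exact: (cvg_pair (cstu _) bP).
  apply: (@closed_cvg _ _ u PF (fun i => (m i.*2, b)) limit_comb cW).
    by apply: (@filterS _ u _ setT) => [i _|]; [exact: Wb | exact: filterT].
  exact: (cvg_pair aP (cstu _)).
have Wa i : limit_comb (m i.*2.+1, a).
  apply: (@closed_cvg _ _ u PF (fun l => (m i.*2.+1, m l.*2)) limit_comb cW).
    (* Here 2i+1 < 2l requires i < l, whereas i <= l was enough for 2i < 2l+1. *)
    apply: (@filterS _ u _ _ _ _ (nonprincipal_geq i.+1)) => l /= il.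
    apply: Wm; first by rewrite -doubleS leq_double.
    by rewrite oddB ?ltn_double //= !odd_double.
  exact: (cvg_pair (cstu _) aP).
apply: (@closed_cvg _ _ u PF (fun i => (m i.*2.+1, a)) limit_comb cW).
  by apply: (@filterS _ u _ setT) => [i _|]; [exact: Wa | exact: filterT].
exact: (cvg_pair bP (cstu _)).
Qed.

(** An ultrafilter [w] on [M] converging to [a] selects a half of the segments. Over [0,1/2] the
    tooth with k = 1 supplies partners, since 1 - [pitch] is at least 1/2; over the other half the
    spine does. The limit of the partners along [w] is [b]. *)
Lemma limit_comb_onto a : beta_map M_proj a = p ->
  exists b, limit_comb (a, b) \/ limit_comb (b, a).
Proof.
move=> /fibre_cvg[w [Uw wa wu]].
have Pw : ProperFilter w := @ultra_proper _ _ Uw.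
have [wl|wr] := in_ultra_setVsetC [set x : @M R | set_val x.2 <= 2^-1 :> R] Uw.
  pose f (x : @M R) : K :=
    seg x.1 (Num.max (set_val x.2) 2^-1 + 1%:R * pitch x.1).
  have [b fb] := @ultra_cvg _ _ _ f Uw (@beta_compact R M).
  exists b; left.
  apply: (@cvg_ultralim _ _ u comb _ w fst (fun x => (beta_emb x, f x))) => //.
    apply: (@filterS _ w _ _ _ _ wl) => x /= xl.
    rewrite -(segK x); apply: comb_tooth => //.
    have /andP[x0 _] := I01_itv x.2.
    by have := @natr_pitch_le R x.1 1 isT; lra.
  exact: (cvg_pair wa fb).
pose f (x : @M R) := seg x.1 0 : K.
have [b fb] := @ultra_cvg _ _ _ f Uw (@beta_compact R M).
exists b; right.
apply: (@cvg_ultralim _ _ u comb _ w fst (fun x => (f x, beta_emb x))) => //.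
  apply: (@filterS _ w _ _ _ _ wr) => x /= /negP; rewrite -ltNge => xr.
  rewrite -(segK x); apply: comb_spine.
  by have /andP[_ ->] := I01_itv x.2; rewrite ltW.
exact: (cvg_pair fb wa).
Qed.

Lemma symmetric_subcontinuum_off_diagonal : exists Z : set (II R p * II R p),
  [/\ subcontinuum Z, Z = (Z^-1)%relation, fst @` Z = [set: II R p]
    & Z `&` diagonal = set0].
Proof.
pose V : set (K * K) := limit_comb `|` limit_comb^-1%relation.
pose fibre : set K := beta_map M_proj @^-1` [set p].
have sV : V `<=` fibre `*` fibre.
  by move=> [a b] [/limit_comb_fibre[]|/limit_comb_fibre[]].
have cswap : continuous (fun z : K * K => (z.2, z.1)).
  by apply: pair_continuous => z; [exact: cvg_snd | exact: cvg_fst].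
have VE : limit_comb^-1%relation = (fun z => (z.2, z.1)) @` limit_comb.
  apply/seteqP; split => [[a b] Wba|_ [[a b] Wab <-]] //.
  by exists (b, a).
have connV : connected V.
  (* The point (a,b) of [limit_comb_swap] is common to the limit and its inverse. *)
  apply: connectedU.
  - by have [a [b [Wab Wba]]] := limit_comb_swap; exists (a, b).
  - exact: limit_comb_connected.
  - rewrite VE; apply: connected_continuous_connected.
      exact: limit_comb_connected.
    exact: continuous_subspaceT.
have closV : closed V.
  apply: closedU; first exact: ultralim_closed.
  apply: ((continuous_closedP _).1 cswap limit_comb); exact: ultralim_closed.
pose val2 (z : II R p * II R p) : K * K := (set_val z.1, set_val z.2).
have cval2 : continuous val2.
  apply: pair_continuous => z.
    apply: (@continuous_comp _ _ _ fst set_val); first exact: cvg_fst.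
    exact: set_val_continuous.
  apply: (@continuous_comp _ _ _ snd set_val); first exact: cvg_snd.
  exact: set_val_continuous.
have cII : compact [set: II R p].
  apply: set_type_compact; apply: (@subclosed_compact _ _ setT) => //.
    apply: ((continuous_closedP _).1 (@beta_map_continuous R _ _ M_proj)
      [set p]).
    by apply: compact_closed; [exact: beta_hausdorff | exact: compact_set1].
  exact: beta_compact.
(* By [sV] all of [V] lies over the square of the fibre, so this pullback loses no points. *)
exists (val2 @^-1` V); split.
- split.
  + have [a [b [Wab _]]] := limit_comb_swap.
    have [pa pb] := limit_comb_fibre a b Wab.
    have Z0 : (val2 @^-1` V) (exist _ a (mem_set pa), exist _ b (mem_set pb)).
      by left.
    by exists (@exist _ (fun z => z \in val2 @^-1` V) _ (mem_set Z0)).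
  + apply: set_type_compact; apply: (@subclosed_compact _ _ setT) => //.
      exact: ((continuous_closedP _).1 cval2 V).
    exact: compact_prodT.
  + by apply: connected_set_typeT; exact: connected_prod_set_type.
  + apply: set_type_hausdorff.
    by apply: hausdorff_prod; apply: set_type_hausdorff; exact: beta_hausdorff.
- by apply/seteqP; split => [[a b] [] ?|[a b] [] ?]; by [right | left].
- apply/seteqP; split => // a _.
  have [b Vab] := limit_comb_onto (set_val a) (set_valP a).
  have pb : beta_map M_proj b = p.
    by case: Vab => /limit_comb_fibre[].
  by exists (a, exist _ b (mem_set pb)).
- apply/seteqP; split => // -[a b] [Vab]; rewrite /diagonal /= => ab.
  by move: Vab; rewrite /val2 /preimage /= ab => -[] /limit_comb_irreflexive.
Qed.

End Main.

Theorem corollary5p4 (R : realType) (CH : continuum_hypothesis R)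
  (u : set_system nat) (Uu : UltraFilter u)
  (nonprincipal_u : forall n : nat, ~ u [set n]) :
  ~ surj_sym_span_zero (II R (ultrafilter_point Uu)) /\
  exists Z : set (II R (ultrafilter_point Uu) * II R (ultrafilter_point Uu)),
    [/\ subcontinuum Z,
        Z = (Z^-1)%relation,
        fst @` Z = [set: II R (ultrafilter_point Uu)]
      & Z `&` diagonal = set0].
Proof.
have [Z [cZ sZ pZ dZ]] :=
  @symmetric_subcontinuum_off_diagonal R u Uu nonprincipal_u.
split; last by exists Z.
by move=> /(_ Z cZ sZ pZ) [z]; rewrite dZ.
Qed.
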